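(* The set of approximately continuous functions $f:\mathbb{R}\to\mathbb{R}$ that are discontinuous (in the usual sense) at Lebesgue-almost every point is strongly $\mathfrak{c}$-algebrable (as a subset of the algebra $\mathbb{R}^{\mathbb{R}}$).
   Context: $\mathfrak{c}=2^{\omega}$ is the cardinality of the continuum. $\mathbb{R}^{\mathbb{R}}$ is the real commutative algebra of all functions $\mathbb{R}\to\mathbb{R}$ with pointwise operations. A subset $S$ of a commutative real algebra $\mathcal{L}$ is strongly $\kappa$-algebrable if $S\cup\{0\}$ contains a $\kappa$-generated algebra isomorphic to a free (commutative, non-unital) algebra; equivalently, there is a set $X\subseteq\mathcal{L}$ of cardinality $\kappa$ such that for every $k\ge 1$, every nonzero real polynomial $P$ in $k$ variables without constant term and all distinct $y_1,\dots,y_k\in X$, we have $P(y_1,\dots,y_k)\neq 0$ and $P(y_1,\dots,y_k)\in S$. The density topology on $\mathbb{R}$ consists of the empty set and all Lebesgue measurable sets $E$ such that $\lim_{h\to0^+}\frac{\lambda(E\cap[x-h,x+h])}{2h}=1$ for every $x\in E$, where $\lambda$ is Lebesgue measure. A function $f:\mathbb{R}\to\mathbb{R}$ is approximately continuous if it is continuous with respect to the density topology on the domain and the natural topology on the range. *)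

(* Defs.v *)
From HB Require Import structures.
From mathcomp Require Import all_boot all_order all_algebra.
From mathcomp Require Import all_classical all_reals all_analysis.
From mathcomp Require Import measurable_realfun.
From mathcomp Require Import -(notations) mpoly.

Set Implicit Arguments.
Unset Strict Implicit.
Unset Printing Implicit Defensive.

Import Order.TTheory GRing.Theory Num.Theory.
Import numFieldNormedType.Exports.

Local Open Scope classical_set_scope.
Local Open Scope ring_scope.

(* The library makes T -> A a commutative ring and an lmodType for the pointwise
   operations; what is missing is the compatibility that makes it an algebra. *)
Section function_algebra.
Variables (T : pointedType) (K : nzRingType) (A : comAlgType K).

Let fct_scalerAl (k : K) (f g : T -> A) : k *: (f * g) = k *: f * g.
Proof. by apply/funext => x; exact: scalerAl. Qed.

HB.instance Definition _ :=
  GRing.Lmodule_isLalgebra.Build K (T -> A) fct_scalerAl.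

Let fct_scalerAr (k : K) (f g : T -> A) : k *: (f * g) = f * (k *: g).
Proof. by apply/funext => x; exact: scalerAr. Qed.

HB.instance Definition _ :=
  GRing.Lalgebra_isAlgebra.Build K (T -> A) fct_scalerAr.

End function_algebra.

Section algebrability.
Variables (K : fieldType) (L : comAlgType K).

(* The value P(y_0, ..., y_(k-1)) in L, scalars being sent to multiples of 1. *)
Definition poly_value (k : nat) (P : mpoly k K) (y : 'I_k -> L) : L :=
  mmap (in_alg L) y P.

(* X freely generates a non-unital algebra contained in S together with 0: its
   elements are the values at points of X of polynomials without constant term,
   the constant term being the coefficient at the zero multi-exponent mnm0.
   The cardinal is given as that of a type kappa. *)
Definition strongly_algebrable (kappa : Type) (S : set L) : Prop :=
  exists X : set L, (X #= [set: kappa])%card /\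
    forall (k : nat) (P : mpoly k K) (y : 'I_k -> L),
      (0 < k)%N ->
      P != 0 -> mcoeff (@mnm0 k) P = 0 ->
      injective y -> (forall i, X (y i)) ->
      poly_value P y != 0 /\ S (poly_value P y).

End algebrability.

Section density_topology.
Variable R : realType.

(* `measurable` on R is Borel measurability in the library, so Lebesgue
   measurability is membership in the completion. *)
Definition lebesgue_measurable (E : set R) : Prop :=
  (completed_algebra_gen (@lebesgue_measure R)).-sigma.-measurable E.

Definition density_point (E : set R) (x : R) : Prop :=
  (fun h : R =>
     fine (completed_lebesgue_measure (E `&` `[x - h, x + h])) / (2 * h))
    @ 0^'+ --> (1 : R).

Definition density_open (E : set R) : Prop :=
  lebesgue_measurable E /\ forall x, E x -> density_point E x.

Definition approximately_continuous (f : R -> R) : Prop :=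
  forall U : set R, open U -> density_open (f @^-1` U).

Definition ae_discontinuous (f : R -> R) : Prop :=
  {ae lebesgue_measure, forall x : R, ~ {for x, continuous f}}.

End density_topology.

(* Main.v *)
Require Import Defs.
From mathcomp Require Import all_boot all_order all_algebra.
From mathcomp Require Import all_classical all_reals all_analysis.
From mathcomp Require Import measurable_realfun.
From mathcomp Require Import -(notations) mpoly.
From mathcomp Require Import ring lra.

Set Implicit Arguments.
Unset Strict Implicit.
Unset Printing Implicit Defensive.

Import Order.TTheory GRing.Theory Num.Theory.
Import numFieldNormedType.Exports.

Local Open Scope classical_set_scope.
Local Open Scope ring_scope.

(** A function that is approximately continuous is of the first Baire class,
hence continuous on a residual set; so the witnesses must be discontinuous on
a set that is of full measure and yet meagre.  The standard shape is a
function [f >= 0] that vanishes on a dense null set and is positive almost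
everywhere: here [f = 1 / (1 + u)], where
[u x = \sum_n c_n / sqrt (|x - q_n| + d_n)] takes values in [[0, +oo]].  The
weights [c_n] are so small that [u 0] is finite, while the widths [d_n] are so
much smaller still that [u] is infinite at every nonzero rational.

Inverse square roots of the distance are weights of Muckenhoupt class A_1: the
average of each term of [u] over an interval centred at [x] is at most a
constant times its value at [x] ([spike_average]), with a constant that
depends neither on the term nor on the interval, and this passes to arbitrary
sums ([integral_potential_le]).  Two things follow.  Since [u 0] is finite,
[u] is locally integrable, hence finite almost everywhere
([potential_ae_finite]).  And if [u x] is finite, then a tail of the series is
small at [x], so by Markov's inequality it is small on most of every interval
centred at [x]; the remaining finite sum is continuous, whence the approximate
continuity of [f] at [x] ([dip_approx_continuous]).  Where [u] is infinite,
[f] vanishes and is even continuous, because [u] is lower semicontinuous.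

The generators are [theta b \o f], where [theta b t = exp (- t ^ (- b))] for
[t > 0] and [theta b 0 = 0], and [b] runs through a set of positive reals that
has the cardinality of the continuum.  A polynomial without constant term in
generators is [phi \o f], where [phi] is continuous and [phi 0 = 0]; so it is
approximately continuous.  In terms of [tau = - ln t], distinct monomials are
[exp (- w)] for exponents [w] that are different combinations of distinct
functions [exp (b tau)].  The difference of two such exponents diverges, so
one monomial dominates all the others, and [phi] has no zero on some interval
[(0, t0)] ([poly_theta_neq0]).

Finally, approximately continuous functions have the intermediate value
property ([approx_continuous_ivt]).  Near a point [x] where [f x > 0] the
function [f] has zeros, so it takes all values in [(0, f x)] there; if
[phi \o f] were continuous at [x], then [phi] would be constant on that
interval, and the constant would be [phi 0 = 0] ([comp_discontinuous]). *)

(** * Approximate continuity *)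

Section approximate_continuity.
Variable R : realType.
Notation lam := (@lebesgue_measure R).
Notation window x h := [set` `[x - h, x + h]].

(** Exceptional sets are bounded by [eta * h] rather than through a limit of
quotients: this form is stable under the inclusions and unions by which it is
established, and involves no division of extended reals. *)
Definition approx_continuous_at (f : R -> R) (x : R) : Prop :=
  forall e eta : R, 0 < e -> 0 < eta -> exists2 d : R, 0 < d &
    forall h, 0 < h < d ->
      (lam (window x h `&` [set y | e <= `|f y - f x|])%R <= (eta * h)%:E)%E.

Lemma le_lebesgue_measure (A B : set R) :
  measurable A -> measurable B -> A `<=` B -> (lam A <= lam B)%E.
Proof. by move=> mA mB; apply: (@le_measure _ _ _ lam); rewrite inE. Qed.

Lemma lebesgue_measure_cc (a b : R) : a <= b -> lam `[a, b] = (b - a)%:E.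
Proof.
move=> ab; rewrite lebesgue_measure_itv /= lte_fin.
have [_|ba] := ltP a b; first by rewrite -EFinB.
by rewrite (_ : b - a = 0)//; apply/eqP; rewrite subr_eq0 eq_le ba ab.
Qed.

Lemma lebesgue_measure_oc (a b : R) : a <= b -> lam `]a, b] = (b - a)%:E.
Proof.
move=> ab; rewrite lebesgue_measure_itv /= lte_fin.
have [_|ba] := ltP a b; first by rewrite -EFinB.
by rewrite (_ : b - a = 0)//; apply/eqP; rewrite subr_eq0 eq_le ba ab.
Qed.

Lemma measurable_dist_ge (f : R -> R) (a e : R) :
  measurable_fun setT f -> measurable [set y | e <= `|f y - a|].
Proof.
move=> mf; rewrite -[X in measurable X]setTI.
rewrite (_ : [set y | _] = (fun y => `|f y - a|) @^-1` `[e, +oo[).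
  apply: (measurableT_comp (@normr_measurable R setT)) => //.
  by apply: measurable_funB => //; exact: measurable_cst.
by apply/seteqP; split => y /=; rewrite in_itv/= andbT.
Qed.

Lemma approx_continuous_at_comp (f g : R -> R) (x : R) :
  measurable_fun setT f -> continuous g ->
  approx_continuous_at f x -> approx_continuous_at (g \o f) x.
Proof.
move=> mf cg fx e eta e0 eta0.
have /cvgrPdist_lt/(_ _ e0) := cg (f x).
move=> /nbhs_ballP[r /= r0 xr].
have [d d0 fd] := fx r eta r0 eta0.
exists d => // h hd; apply: le_trans (fd h hd); apply: le_lebesgue_measure.
- apply: measurableI => //.
  apply: measurable_dist_ge; apply: measurableT_comp => //.
  exact: continuous_measurable_fun.
- by apply: measurableI => //; exact: measurable_dist_ge.
- move=> y [xhy /= ge]; split => //=; rewrite leNgt; apply/negP => fr.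
  have := xr (f y); rewrite /ball /= distrC => /(_ fr).
  by rewrite distrC ltNge ge.
Qed.

Lemma measurable_lebesgue_measurable (E : set R) :
  measurable E -> lebesgue_measurable E.
Proof.
move=> mE; apply: sub_sigma_algebra; exists E => //.
by exists set0; [exact: negligible_set0 | rewrite setU0].
Qed.

Lemma density_point_small_complement (E : set R) (x : R) :
  measurable E ->
  (forall eta : R, 0 < eta -> exists2 d : R, 0 < d &
    forall h, 0 < h < d ->
      (lam (window x h `&` ~` E) <= (eta * h)%:E)%E) ->
  density_point E x.
Proof.
move=> mE small; rewrite /density_point; apply/cvgrPdist_le => e e0.
have [d d0 Ed] := small _ e0.
near=> h.
have h0 : 0 < h by near: h; exact: nbhs_right_gt.
have hd : h < d by near: h; exact: nbhs_right_lt.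
have mI : measurable (window x h) by [].
have Ih : lam (window x h) = (2 * h)%:E.
  by rewrite lebesgue_measure_cc; [congr EFin; ring|lra].
have mIE : measurable (window x h `&` E) by exact: measurableI.
have mIC : measurable (window x h `&` ~` E).
  by apply: measurableI => //; exact: measurableC.
have split_I : (lam (window x h `&` E) + lam (window x h `&` ~` E)
    = (2 * h)%:E)%E.
  rewrite -Ih -measureU//; first by rewrite -setIUr setUCr setIT.
  by rewrite setICA -setIA setICr !setI0.
have fE : lam (E `&` window x h) \is a fin_num.
  rewrite ge0_fin_numE ?measure_ge0// (@le_lt_trans _ _ (2 * h)%:E) ?ltry//.
  by rewrite -split_I setIC leeDl// measure_ge0.
have := split_I; have := Ed h; rewrite h0 hd => /(_ isT).
have : (0 <= lam (window x h `&` ~` E))%E by exact: measure_ge0.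
rewrite [window x h `&` E]setIC -(fineK fE).
change (fine (completed_lebesgue_measure _)) with (fine (lam (E `&` window x h))).
move: (fine _) => p; case: (lam _) => // q; rewrite !lee_fin => q0 qe [pq].
have -> : p = 2 * h - q by lra.
rewrite (_ : 1 - _ = q / (2 * h)); last by field; rewrite gt_eqF.
rewrite ger0_norm; last by apply: divr_ge0 => //; lra.
by rewrite ler_pdivrMr; lra.
Unshelve. all: by end_near. Qed.

Lemma approximately_continuous_pointwise (f : R -> R) :
  measurable_fun setT f -> (forall x, approx_continuous_at f x) ->
  approximately_continuous f.
Proof.
move=> mf cf U oU.
have mU : measurable (f @^-1` U).
  by rewrite -[X in measurable X]setTI; apply: mf => //; exact: open_measurable.
split; first exact: measurable_lebesgue_measurable.
move=> x Ufx; apply: density_point_small_complement => // eta eta0.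
have /nbhs_ballP[r /= r0 xr] : nbhs (f x) U by exact: open_nbhs_nbhs.
have [d d0 fd] := cf x r eta r0 eta0; exists d => // h hd.
apply: le_trans (fd h hd); apply: le_lebesgue_measure.
- by apply: measurableI => //; exact: measurableC.
- by apply: measurableI => //; exact: measurable_dist_ge.
- move=> y [xhy /= NU]; split => //=; rewrite leNgt; apply/negP => fr.
  by apply/NU/xr; rewrite /ball /= distrC.
Qed.

(** The interval [[a, b]] is connected for the density topology.  Integrate
[1] on [A] and [- 1] off [A]: the resulting function [G] increases to the right
of each point of [A] and decreases from the left up to each point off [A].
Hence the maximum of [G] on [[a, b]] is attained neither at a point of [A],
as [b] is not one, nor at a point off [A], as [a] is not one.  One-sided
intervals are what counts here: an exceptional set of measure at most [h / 4]
in the symmetric interval leaves at least [3 / 4] of either half. *)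
Lemma darboux_density (A : set R) (a b : R) :
  measurable A -> a < b -> A a -> ~ A b ->
  (forall z, a <= z <= b -> A z -> exists2 d : R, 0 < d & forall h, 0 < h < d ->
     (lam (window z h `&` ~` A) <= (h / 4)%:E)%E) ->
  (forall z, a <= z <= b -> ~ A z -> exists2 d : R, 0 < d & forall h, 0 < h < d ->
     (lam (window z h `&` A) <= (h / 4)%:E)%E) ->
  False.
Proof.
move=> mA ab Aa NAb thick thin.
pose D z w := fine (lam (A `&` `]z, w])).
have mD z w : measurable (A `&` `]z, w]) by exact: measurableI.
have finD z w : lam (A `&` `]z, w]) \is a fin_num.
  have [zw|wz] := leP z w; last first.
    by rewrite set_itv_ge ?setI0 ?measure0//= bnd_simp -leNgt ltW.
  rewrite ge0_fin_numE ?measure_ge0// (@le_lt_trans _ _ (w - z)%:E) ?ltry//.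
  by rewrite -lebesgue_measure_oc//; apply: le_lebesgue_measure => //; exact: subIsetr.
have D_ge0 z w : 0 <= D z w by exact/fine_ge0/measure_ge0.
have D_le z w : z <= w -> D z w <= w - z.
  move=> zw; rewrite -lee_fin /D fineK// -lebesgue_measure_oc//.
  by apply: le_lebesgue_measure => //; exact: subIsetr.
have DD z w t : z <= w -> w <= t -> D z t = D z w + D w t.
  move=> zw wt; rewrite /D -fineD// -measureU//.
    congr (fine (lam _)); rewrite -setIUr; congr (_ `&` _).
    by rewrite -itv_bndbnd_setU// bnd_simp.
  1,2: exact: mD.
  apply/seteqP; split => // y /= [[_]].
  rewrite !in_itv/= => /andP[_ yw] [_ /andP[wy _]].
  by move: wy; rewrite ltNge yw.
(* A primitive of the indicator of A, on the whole line so that it is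
   continuous without any restriction of the domain. *)
pose F z := if z < a then - D z a else D a z.
have FE z w : z <= w -> F w - F z = D z w.
  move=> zw; rewrite /F.
  have [za|az] := ltP z a; have [wa|aw] := ltP w a.
  - by rewrite (DD z w a) ?(ltW wa)//; ring.
  - by rewrite (DD z a w) ?(ltW za)//; ring.
  - by have := le_lt_trans zw wa; rewrite ltNge az.
  - by rewrite (DD a z w)//; ring.
have cF : continuous F.
  move=> z; apply/cvgrPdist_lt => e e0.
  near=> w.
  have zw : `|z - w| < e by near: w; exact: cvgr_dist_lt.
  apply: le_lt_trans zw.
  have [|/ltW] := leP z w => le.
    by rewrite distrC FE// ger0_norm// distrC ger0_norm ?subr_ge0// D_le.
  by rewrite FE// ger0_norm// ger0_norm ?subr_ge0// D_le.
pose G z := 2 * F z - z.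
have cG : {within `[a, b], continuous G}.
  apply: continuous_subspaceT => z; apply: cvgB; last exact: cvg_id.
  by apply: cvgM; [exact: cvg_cst|exact: cF].
have [c /[!in_itv]/= /andP[ac cb] maxG] := EVT_max (ltW ab) cG.
have [Ac|NAc] := pselect (A c).
  have {}cb : c < b by rewrite lt_neqAle cb andbT; apply: contra_notN NAb => /eqP <-.
  have [|d d0 dh] := thick c _ Ac; first by rewrite ac ltW.
  pose h := Num.min (d / 2) (b - c).
  have h0 : 0 < h by rewrite lt_min divr_gt0//= subr_gt0.
  have hd : h < d by rewrite gt_min ltr_pdivrMr// ltr_pMr// ltr1n.
  have hb : h <= b - c by rewrite ge_min lexx orbT.
  have /maxG : c + h \in `[a, b] by rewrite in_itv/=; lra.
  rewrite /G; have /FE Fc : c <= c + h by lra.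
  have : h <= D c (c + h) + h / 4.
    rewrite -lee_fin EFinD /D fineK//.
    have -> : h%:E = lam `]c, c + h].
      by rewrite lebesgue_measure_oc; [congr EFin; ring|lra].
    rewrite -[X in (lam X <= _)%E](setIT _) -(setUCr A) setIUr.
    apply: le_trans (measureU2 _ _ _) _ => //.
    - exact: measurableI.
    - by apply: measurableI => //; exact: measurableC.
    rewrite setIC leeD2l//; apply: le_trans (dh h _); last by rewrite h0.
    apply: le_lebesgue_measure => //.
    + by apply: measurableI => //; exact: measurableC.
    + by apply: measurableI => //; exact: measurableC.
    + by apply: setSI => y /=; rewrite !in_itv/=; lra.
  lra.
have {}ac : a < c by rewrite lt_neqAle ac andbT; apply: contra_notN NAc => /eqP <-.
have [|d d0 dh] := thin c _ NAc; first by rewrite cb ltW.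
pose h := Num.min (d / 2) (c - a).
have h0 : 0 < h by rewrite lt_min divr_gt0//= subr_gt0.
have hd : h < d by rewrite gt_min ltr_pdivrMr// ltr_pMr// ltr1n.
have hb : h <= c - a by rewrite ge_min lexx orbT.
have /maxG : c - h \in `[a, b] by rewrite in_itv/=; lra.
rewrite /G; have /FE Fc : c - h <= c by lra.
have : D (c - h) c <= h / 4.
  rewrite -lee_fin /D fineK//; apply: le_trans (dh h _); last by rewrite h0.
  apply: le_lebesgue_measure => //; first exact: measurableI.
  by rewrite setIC; apply: setSI => y /=; rewrite !in_itv/=; lra.
lra.
Unshelve. all: by end_near. Qed.

(** If [f] missed [t] between [a] and [b], then [f < t] and [t < f] would
split the interval into two sets open for the density topology. *)
Lemma approx_continuous_ivt (f : R -> R) (a b t : R) :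
  measurable_fun setT f ->
  (forall x, approx_continuous_at f x) ->
  f a < t < f b -> exists2 c, Num.min a b <= c <= Num.max a b & f c = t.
Proof.
move=> mf cf /andP[at_ tb]; apply: contrapT => noc.
have ne z : Num.min a b <= z <= Num.max a b -> f z != t.
  by move=> zab; apply/eqP => fz; apply: noc; exists z.
have mlt : measurable [set y | f y < t].
  rewrite -[X in measurable X]setTI (_ : [set y | _] = f @^-1` `]-oo, t[).
    exact: mf.
  by apply/seteqP; split => y /=; rewrite in_itv.
have mgt : measurable [set y | t < f y].
  rewrite -[X in measurable X]setTI (_ : [set y | _] = f @^-1` `]t, +oo[).
    exact: mf.
  by apply/seteqP; split => y /=; rewrite in_itv/= andbT.
have q0 : 0 < 4^-1 :> R by [].
have thin z (B : set R) : measurable B -> f z != t ->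
    B `<=` [set y | `|f z - t| <= `|f y - f z|] ->
    exists2 d : R, 0 < d & forall h, 0 < h < d ->
     (lam (window z h `&` B) <= (h / 4)%:E)%E.
  move=> mB fzt sB; have [|d d0 dh] := cf z `|f z - t| 4^-1 _ q0.
    by rewrite normr_gt0 subr_eq0.
  exists d => // h hd; rewrite mulrC; apply: le_trans (dh h hd).
  apply: le_lebesgue_measure; first exact: measurableI.
  - by apply: measurableI => //; exact: measurable_dist_ge.
  - exact: setIS.
have [ab|ba|ab] := ltgtP a b; last by have := lt_trans at_ tb; rewrite ab ltxx.
- apply: (@darboux_density [set y | f y < t] a b) => //=.
  + by rewrite ltNge (ltW tb).
  + move=> z zab fz; apply: thin => //; first exact: measurableC.
      by rewrite lt_eqF.
    move=> y /=; rewrite ltNge => /negP; rewrite negbK => ty.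
    by rewrite ltr0_norm ?subr_lt0// ger0_norm; lra.
  + move=> z zab fz; apply: thin; first exact: mlt.
      by apply: ne; rewrite (min_l (ltW ab)) (max_r (ltW ab)).
    have {}fz : t <= f z by rewrite leNgt; exact/negP.
    by move=> y /= ty; rewrite ger0_norm ?subr_ge0// ler0_norm; lra.
- apply: (@darboux_density [set y | t < f y] b a) => //=.
  + by rewrite ltNge (ltW at_).
  + move=> z zab fz; apply: thin => //; first exact: measurableC.
      by rewrite gt_eqF.
    move=> y /=; rewrite ltNge => /negP; rewrite negbK => ty.
    by rewrite gtr0_norm ?subr_gt0// ler0_norm; lra.
  + move=> z zab fz; apply: thin; first exact: mgt.
      by apply: ne; rewrite (min_r (ltW ba)) (max_l (ltW ba)).
    have {}fz : f z <= t by rewrite leNgt; exact/negP.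
    by move=> y /= ty; rewrite ler0_norm ?subr_le0// gtr0_norm; lra.
Qed.

End approximate_continuity.

(** * Reciprocals of lower semicontinuous potentials *)

Section damping.
Variable R : realType.

(** The value of [1 / (1 + u)], with [1 / (1 + +oo) = 0]. *)
Definition damp (u : \bar R) : R := if u is r%:E then (1 + r)^-1 else 0.

Lemma damp_gt0 (u : \bar R) : (0 <= u)%E -> (u < +oo)%E -> 0 < damp u.
Proof. by case: u => //= r; rewrite lee_fin invr_gt0 => r0 _; lra. Qed.

Lemma damp_le (s : R) (u : \bar R) : 0 <= s -> (s%:E <= u)%E -> damp u <= (1 + s)^-1.
Proof.
move=> s0; case: u => [r|_|_] /=; last 2 first.
- by rewrite invr_ge0; lra.
- by rewrite invr_ge0; lra.
by rewrite lee_fin => sr; rewrite lef_pV2 ?posrE; lra.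
Qed.

(** [s |-> 1 / (1 + s)] is 1-Lipschitz on nonnegative reals. *)
Lemma damp_addr (s e : R) (t : \bar R) : 0 <= s -> (0 <= t)%E -> (t < e%:E)%E ->
  0 <= (1 + s)^-1 - damp (s%:E + t) < e.
Proof.
move=> s0; case: t => [t|//|//]; rewrite lee_fin lte_fin => t0 te.
apply/andP; split.
  by rewrite subr_ge0 damp_le// leeDl.
rewrite /= (_ : _ - _ = t / ((1 + s) * (1 + (s + t)))); last first.
  by field; apply/andP; split; rewrite gt_eqF//; lra.
apply: le_lt_trans te; rewrite ler_pdivrMr; last by rewrite mulr_gt0; lra.
by rewrite ler_peMr// mulr_ege1//; lra.
Qed.

End damping.

Section potential.
Variable R : realType.
Notation lam := (@lebesgue_measure R).
Notation window x h := [set` `[x - h, x + h]].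

Definition potential (g : nat -> R -> R) (x : R) : \bar R :=
  (\sum_(0 <= n <oo) (g n x)%:E)%E.

(** The A_1 condition of Muckenhoupt, uniformly in [n].  The left-hand side is
[2 * h] times an average, so the A_1 constant is [K / 2]. *)
Definition average_bounded (K : R) (g : nat -> R -> R) :=
  forall n x h, 0 < h ->
    (\int[lam]_(y in window x h) (g n y)%:E <= (K * h * g n x)%:E)%E.

Variable g : nat -> R -> R.
Hypothesis g_ge0 : forall n x, 0 <= g n x.
Hypothesis g_cont : forall n, continuous (g n).

Let gE_ge0 n x : (0 <= (g n x)%:E)%E. Proof. by rewrite lee_fin. Qed.

Lemma measurable_potential : measurable_fun setT (potential g).
Proof.
apply: ge0_emeasurable_sum => // n _.
by apply/measurable_EFinP; exact: continuous_measurable_fun.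
Qed.

Lemma potential_ge0 x : (0 <= potential g x)%E.
Proof. exact: nneseries_ge0. Qed.

Lemma integral_potential_le K x h : average_bounded K g -> 0 < K -> 0 < h ->
  (\int[lam]_(y in window x h) potential g y <= (K * h)%:E * potential g x)%E.
Proof.
move=> avg K0 h0; rewrite integral_nneseries//; last first.
  move=> n; apply/measurable_EFinP; apply: measurable_funTS.
  exact: continuous_measurable_fun.
rewrite /potential -nneseriesZl//; apply: lee_nneseries.
  by move=> n _ _; exact: integral_ge0.
by move=> n _; rewrite -EFinM; exact: avg.
Qed.

Definition partial (N : nat) (x : R) : R := \sum_(0 <= n < N) g n x.

Lemma partial_ge0 N x : 0 <= partial N x.
Proof. by apply: sumr_ge0. Qed.

Lemma partial_cont N : continuous (partial N).
Proof.
move=> x; elim: N => [|N IH].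
  have -> : partial 0 = cst 0 by apply/funext => y; rewrite /partial big_geq.
  exact: cvg_cst.
have -> : partial N.+1 = (fun y => partial N y + g N y).
  by apply/funext => y; rewrite /partial big_nat_recr.
by apply: cvgD => //; exact: g_cont.
Qed.

Lemma partial_damp_cont N : continuous (fun x => (1 + partial N x)^-1).
Proof.
move=> x; have := partial_ge0 N x => p0.
apply: cvgV; first by rewrite gt_eqF//; lra.
by apply: cvgD; [exact: cvg_cst|exact: partial_cont].
Qed.

Lemma partial_le_potential N x : ((partial N x)%:E <= potential g x)%E.
Proof. by rewrite /partial -sumEFin; exact: nneseries_lim_ge. Qed.

Lemma potential_split N x :
  potential g x = ((partial N x)%:E + potential (fun n => g (n + N)) x)%E.
Proof.
rewrite /potential (nneseries_split _ N)// /partial -sumEFin add0n.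
by rewrite (nneseries_addn N (f := fun n => (g n x)%:E)).
Qed.

Lemma potential_tail_small x (e : R) : (potential g x < +oo)%E -> 0 < e ->
  \forall N \near \oo, (potential (fun n => g (n + N)) x < e%:E)%E.
Proof.
move=> ufin e0; have /fine_cvgP[] := nneseries_tail_cvg ufin (fun n _ => gE_ge0 n x).
move=> finN /cvgrPdist_lt/(_ _ e0) smallN.
near=> N; rewrite /potential (nneseries_addn N (f := fun n => (g n x)%:E))//.
have fin : (\sum_(N <= k <oo) (g k x)%:E)%E \is a fin_num by near: N.
rewrite -(fineK fin) lte_fin.
have : `|0 - fine (\sum_(N <= k <oo) (g k x)%:E)%E| < e by near: N.
by rewrite sub0r normrN ger0_norm// fine_ge0//; exact: nneseries_ge0.
Unshelve. all: by end_near. Qed.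

Lemma partial_unbounded x (A : R) : potential g x = +oo%E ->
  \forall N \near \oo, A < partial N x.
Proof.
move=> uoo; have : (\sum_(0 <= n < N) (g n x)%:E)%E @[N --> \oo] --> potential g x.
  by apply: is_cvg_nneseries.
rewrite uoo => /cvgeyPgt/(_ A); apply: filterS => N.
by rewrite sumEFin lte_fin.
Qed.

(** This function dips to [0] exactly where the potential is infinite. *)
Definition dip (x : R) : R := damp (potential g x).

Lemma dip_ge0 x : 0 <= dip x.
Proof.
rewrite /dip; have := potential_ge0 x; case: (potential g x) => //= r.
by rewrite lee_fin invr_ge0; lra.
Qed.

Lemma partial_damp_cvg x : (1 + partial N x)^-1 @[N --> \oo] --> dip x.
Proof.
apply/cvgrPdist_lt => e e0.
have [ufin|] := ltP (potential g x) +oo%E; last first.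
  rewrite leye_eq => /eqP uoo; near=> N.
  rewrite /dip uoo /= sub0r normrN; have := partial_ge0 N x => p0.
  rewrite ger0_norm ?invr_ge0; last lra.
  rewrite -[e]invrK ltf_pV2 ?posrE ?invr_gt0//; last lra.
  have : e^-1 < partial N x by near: N; exact: partial_unbounded.
  lra.
near=> N; rewrite /dip (potential_split N) distrC.
have small : (potential (fun n => g (n + N)) x < e%:E)%E.
  by near: N; exact: potential_tail_small.
have tail_ge0 : (0 <= potential (fun n => g (n + N)) x)%E by exact: nneseries_ge0.
have /andP[ge0 lte] := damp_addr (partial_ge0 N x) tail_ge0 small.
by rewrite ger0_norm.
Unshelve. all: by end_near. Qed.

Lemma measurable_dip : measurable_fun setT dip.
Proof.
apply: (measurable_fun_cvg (h := fun N x => (1 + partial N x)^-1)) => [N|x _].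
  by apply: continuous_measurable_fun; exact: partial_damp_cont.
exact: partial_damp_cvg.
Qed.

End potential.

Section dip_theory.
Variable R : realType.
Notation lam := (@lebesgue_measure R).
Notation window x h := [set` `[x - h, x + h]].
Variables (K : R) (g : nat -> R -> R).
Hypothesis K0 : 0 < K.
Hypothesis g_ge0 : forall n x, 0 <= g n x.
Hypothesis g_cont : forall n, continuous (g n).
Hypothesis g_avg : average_bounded K g.

(** Markov's inequality for the tail of the series, whose integral is under
control because the tail satisfies the same A_1 condition. *)
Let tail_measure_le N x h (e : R) : 0 < h -> 0 < e ->
  (lam (window x h `&` [set y | e%:E <= potential (fun n => g (n + N)) y])
    <= (K * h / e)%:E * potential (fun n => g (n + N)) x)%E.
Proof.
move=> h0 e0; set T := potential _.
have mT : measurable_fun (window x h) T.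
  by apply: measurable_funTS; exact: measurable_potential.
have := le_integral_abse lam (measurable_itv `[x - h, x + h]) mT e0.
have T0 y : (0 <= T y)%E by exact: potential_ge0.
rewrite [X in (lam X)](_ : _ = window x h `&` [set y | (e%:E <= `|T y|)%E]); last first.
  by congr (_ `&` _); apply/seteqP; split => y /=; rewrite gee0_abs.
under [in X in (_ <= X)%E -> _]eq_integral do rewrite gee0_abs//.
move=> le1.
have le2 : (\int[lam]_(y in window x h) T y <= (K * h)%:E * T x)%E.
  apply: integral_potential_le => //.
  by move=> n; exact: g_avg.
have := le_trans le1 le2.
rewrite muleC -lee_pdivlMr// => /le_trans; apply.
by rewrite muleAC -EFinM.
Qed.

(** Where the potential is infinite, a large partial sum already forces [dip]
to be small nearby.  Where it is finite, [dip] is within [e / 2] of the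
reciprocal of a continuous partial sum as soon as the tail is below [e / 2],
which fails only on a set of small density. *)
Lemma dip_approx_continuous x : approx_continuous_at (dip g) x.
Proof.
move=> e eta e0 eta0.
have near_x N (c : R) : 0 < c -> exists2 r : R, 0 < r &
    forall y, `|x - y| < r -> `|(1 + partial g N x)^-1 - (1 + partial g N y)^-1| < c.
  move=> c0; have /cvgrPdist_lt/(_ _ c0) := partial_damp_cont g_ge0 g_cont (N:=N) (x:=x).
  by move=> /nbhs_ballP[r /= r0 xr]; exists r => // y; exact: xr.
have window_near h y : window x h y -> `|x - y| <= h.
  by rewrite /= in_itv/= => xhy; rewrite ler_norml; lra.
have [ufin|] := ltP (potential g x) +oo%E; last first.
  rewrite leye_eq => /eqP uoo.
  have [N _ /(_ N (leqnn N)) /= big] := partial_unbounded g_ge0 (2 / e) uoo.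
  have [r r0 xr] := near_x N (e / 2) (divr_gt0 e0 (ltr0Sn R 1)).
  exists r => // h /andP[h0 hr].
  rewrite (_ : _ `&` _ = set0) ?measure0 ?lee_fin ?mulr_ge0 ?ltW//.
  rewrite -subset0 => y [/window_near xy /=].
  rewrite {2}/dip uoo /= subr0 ger0_norm ?dip_ge0//.
  have dipy := damp_le (partial_ge0 g_ge0 N y) (partial_le_potential g_ge0 N y).
  move=> /le_trans/(_ dipy).
  have := xr y (le_lt_trans xy hr).
  have : (1 + partial g N x)^-1 <= e / 2.
    rewrite -[e / 2]invrK lef_pV2 ?posrE ?invr_gt0//; rewrite ?invf_div; first lra.
    - by have := divr_gt0 (ltr0Sn R 1) e0; lra.
    - by rewrite divr_gt0.
  by rewrite ltr_norml; lra.
(* The second bound on the tail at x makes K * h / (e / 2) * c at most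
   eta * h in Markov's inequality. *)
pose c := Num.min (e / 2) (eta * (e / 2) / K).
have c0 : 0 < c by rewrite lt_min !divr_gt0// mulr_gt0// divr_gt0.
have [N _ /(_ N (leqnn N)) /= small] := potential_tail_small g_ge0 ufin c0.
have e20 : 0 < e / 2 by rewrite divr_gt0.
have [r r0 xr] := near_x N (e / 2) e20.
exists r => // h /andP[h0 hr].
have tail_ge0 y : (0 <= potential (fun n => g (n + N)) y)%E by exact: potential_ge0.
apply: (@le_trans _ _ (lam (window x h `&`
    [set y | ((e / 2)%:E <= potential (fun n => g (n + N)) y)%E]))).
  apply: le_lebesgue_measure.
  - by apply: measurableI => //; apply: measurable_dist_ge; exact: measurable_dip.
  - apply: measurableI => //.
    rewrite -[X in measurable X]setTI.
    by apply: emeasurable_fun_c_infty => //; exact: measurable_potential.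
  - move=> y [xhy /= bad]; split => //=; rewrite leNgt; apply/negP => small_y.
    have /andP[ay ay'] := damp_addr (partial_ge0 g_ge0 N y) (tail_ge0 y) small_y.
    have small_x := lt_le_trans small (_ : (c%:E <= (e / 2)%:E)%E).
    have {}small_x : (potential (fun n => g (n + N)) x < (e / 2)%:E)%E.
      by apply: small_x; rewrite lee_fin ge_min lexx.
    have /andP[ax ax'] := damp_addr (partial_ge0 g_ge0 N x) (tail_ge0 x) small_x.
    move: ay ay' ax ax'; rewrite -!potential_split//.
    have := xr y (le_lt_trans (window_near _ _ xhy) hr).
    move: bad; rewrite /dip ltr_norml.
    set p := damp _; set q := damp _; move=> bad + p1 p2 q1 q2.
    by move: bad; rewrite ler_normr => /orP[]; lra.
apply: le_trans (tail_measure_le N x h0 e20) _.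
have Khe : 0 <= K * h / (e / 2) by rewrite divr_ge0 ?ltW// mulr_gt0.
apply: (@le_trans _ _ ((K * h / (e / 2))%:E * c%:E)%E).
  by apply: lee_wpmul2l; rewrite ?lee_fin// ltW.
rewrite -EFinM lee_fin.
apply: (@le_trans _ _ (K * h / (e / 2) * (eta * (e / 2) / K))).
  by apply: ler_wpM2l => //; rewrite ge_min lexx orbT.
rewrite le_eqVlt; apply/orP; left; apply/eqP; field.
by rewrite !gt_eqF.
Qed.

(** By the A_1 condition, one point of finiteness makes the potential
integrable over every interval centred there. *)
Lemma potential_ae_finite x0 : (potential g x0 < +oo)%E ->
  {ae lam, forall x, (potential g x < +oo)%E}.
Proof.
move=> fin0.
have : {ae lam, forall x, forall n : nat,
    window x0 n.+1%:R x -> potential g x \is a fin_num}.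
  apply: ae_foralln => n.
  apply: (@integrable_ae _ _ _ lam _ (measurable_itv `[x0 - n.+1%:R, x0 + n.+1%:R])).
  apply/integrableP; split.
    by apply: measurable_funTS; exact: measurable_potential.
  under eq_integral do rewrite gee0_abs ?potential_ge0//.
  apply: le_lt_trans (integral_potential_le g_ge0 g_cont x0 g_avg K0 (ltr0Sn _ n)) _.
  rewrite -ge0_fin_numE ?mule_ge0 ?lee_fin ?mulr_ge0 ?potential_ge0 ?ltW//.
  by rewrite fin_numM// ge0_fin_numE// potential_ge0.
apply: (@filterS _ _ (ae_filter_ringOfSetsType lam)) => x fin.
rewrite -ge0_fin_numE ?potential_ge0//.
have [n xn] : exists n : nat, `|x - x0| < n.+1%:R.
  exists (Num.truncn `|x - x0|); exact: truncnS_gt.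
apply: (fin n); rewrite /= in_itv/=; move: xn; rewrite ltr_norml; lra.
Qed.

End dip_theory.

(** * An inverse square root satisfies the A_1 condition *)

Section spike.
Variable R : realType.
Notation lam := (@lebesgue_measure R).
Notation window x h := [set` `[x - h, x + h]].

(** The shift by [d > 0] keeps the function continuous and real-valued; the
bounds below do not depend on [d]. *)
Definition spike (q d y : R) : R := (Num.sqrt (`|y - q| + d))^-1.

Lemma spike_gt0 q d y : 0 < d -> 0 < spike q d y.
Proof. by move=> d0; rewrite invr_gt0 sqrtr_gt0 ltr_wpDl. Qed.

Lemma spike_cont q d : 0 < d -> continuous (spike q d).
Proof.
move=> d0 y; apply: cvgV; first by rewrite gt_eqF// sqrtr_gt0 ltr_wpDl.
apply: continuous_comp; last exact: sqrt_continuous.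
apply: cvgD; last exact: cvg_cst.
by apply: cvg_norm; apply: cvgB; [exact: cvg_id|exact: cvg_cst].
Qed.

Lemma spike_le q d x y (k : R) : 0 < d -> 0 < k ->
  `|x - q| + d <= k ^+ 2 * (`|y - q| + d) -> spike q d y <= k * spike q d x.
Proof.
move=> d0 k0 le_xy.
have p z : 0 < Num.sqrt (`|z - q| + d) by rewrite sqrtr_gt0 ltr_wpDl.
rewrite /spike ler_pdivlMr// mulrC ler_pdivrMr//.
have {1}-> : k = Num.sqrt (k ^+ 2) by rewrite sqrtr_sqr gtr0_norm.
rewrite -sqrtrM ?sqr_ge0//.
by rewrite ler_sqrt// mulr_ge0 ?sqr_ge0// addr_ge0// ltW.
Qed.

(** On either side of [q], the distance to [q] is [s * (y - q)] for a sign [s],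
and a primitive is [2 * s * sqrt (s * (y - q) + d)]. *)
Lemma integral_spike_side (s q d a b : R) : s * s = 1 -> 0 < d -> a < b ->
  (forall y, a <= y <= b -> 0 <= s * (y - q)) ->
  (\int[lam]_(y in [set` `[a, b]]) (spike q d y)%:E =
   (2 * s * Num.sqrt (s * (b - q) + d))%:E - (2 * s * Num.sqrt (s * (a - q) + d))%:E)%E.
Proof.
move=> ss d0 ab side.
pose F y := 2 * s * Num.sqrt (s * (y - q) + d).
have normE y : a <= y <= b -> `|y - q| = s * (y - q).
  move=> /side ge0; have : (s - 1) * (s + 1) == 0 by apply/eqP;
    transitivity (s * s - 1); [ring|rewrite ss subrr].
  rewrite mulf_eq0 subr_eq0 addr_eq0 => /orP[] /eqP sE; move: ge0; rewrite sE.
    by rewrite !mul1r => /ger0_norm.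
  by rewrite !mulN1r oppr_ge0 => /ler0_norm.
have cF : continuous F.
  move=> y; apply: cvgM; first exact: cvg_cst.
  apply: continuous_comp; last exact: sqrt_continuous.
  apply: cvgD; last exact: cvg_cst.
  apply: cvgM; first exact: cvg_cst.
  by apply: cvgB; [exact: cvg_id|exact: cvg_cst].
have dF y : a <= y <= b -> is_derive y 1 F (spike q d y).
  move=> yab; have pos : 0 < s * (y - q) + d by rewrite ltr_wpDl// side.
  have dl : is_derive y 1 (fun y : R => s * (y - q) + d) s.
    apply: is_derive_eq; rewrite /GRing.scale/=; ring.
  have dr := is_derive1_sqrt pos.
  have := is_derive1_comp (f := Num.sqrt) (g := fun y : R => s * (y - q) + d).
  move=> /(_ _ _ _ dr dl) dc.
  have -> : F = (fun y => (2 * s) *: (Num.sqrt \o (fun y : R => s * (y - q) + d)) y).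
    by apply/funext.
  apply: is_derive_eq; rewrite /GRing.scale /= /spike normE//.
  rewrite invfM; transitivity (s * s * (2 * 2^-1) * (Num.sqrt (s * (y - q) + d))^-1).
    by ring.
  by rewrite ss divff// mulr1 mul1r.
rewrite (continuous_FTC2 (F := F) ab)//.
- by apply: continuous_subspaceT; exact: spike_cont.
- split.
  + move=> y; rewrite in_itv/= => /andP[ay yb].
    by have [] := dF y; rewrite ?(ltW ay) ?(ltW yb).
  + by apply: cvg_at_right_filter; exact: cF.
  + by apply: cvg_at_left_filter; exact: cF.
- move=> y; rewrite in_itv/= => /andP[ay yb].
  by rewrite derive1E; have [|_ ->] := dF y; rewrite ?(ltW ay) ?(ltW yb).
Qed.

(** If [h] is at most half of [|x - q| + d], then the spike varies by a bounded
factor on the interval.  Otherwise the interval lies within [3 * h] of [q],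
where the integral is at most [4 * sqrt (3 * h)], while the spike at [x] is at
least [1 / sqrt (2 * h)]. *)
Lemma spike_average q d x h : 0 < d -> 0 < h ->
  (\int[lam]_(y in window x h) (spike q d y)%:E <= (16 * h * spike q d x)%:E)%E.
Proof.
move=> d0 h0.
have mspike (A : set R) : measurable_fun A (fun y => (spike q d y)%:E).
  apply/measurable_EFinP; apply: measurable_funTS.
  by apply: continuous_measurable_fun; exact: spike_cont.
have spikeE y : (0 <= (spike q d y)%:E)%E by rewrite lee_fin ltW// spike_gt0.
have [hr|rh] := leP (2 * h) (`|x - q| + d).
  apply: (@le_trans _ _ (\int[lam]_(y in window x h) (2 * spike q d x)%:E)%E).
    apply: ge0_le_integral => //; first exact: mspike.
    move=> y; rewrite /= in_itv/= => xhy.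
    rewrite lee_fin; apply: spike_le => //.
    have := ler_distD y x q; have : `|x - y| <= h by rewrite ler_norml; lra.
    have := normr_ge0 (y - q); lra.
  rewrite integral_cst//= lebesgue_measure_cc; last lra.
  by rewrite -EFinM lee_fin; have := mulr_gt0 h0 (spike_gt0 q x d0); lra.
set L := 3 * h; have L0 : 0 < L by rewrite mulr_gt0.
pose M := Num.sqrt (L + d) - Num.sqrt d.
have right_side : (\int[lam]_(y in [set` `[q, (q + L)%R]]) (spike q d y)%:E =
    (2 * M)%:E)%E.
  rewrite (@integral_spike_side 1)//;
    [|exact: mulr1|by rewrite ltrDl|by move=> y; rewrite mul1r; lra].
  have -> : 1 * (q + L - q) + d = L + d by ring.
  have -> : 1 * (q - q) + d = d by ring.
  by rewrite -EFinB /M; congr EFin; ring.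
have left_side : (\int[lam]_(y in [set` `[(q - L)%R, q]]) (spike q d y)%:E =
    (2 * M)%:E)%E.
  rewrite (@integral_spike_side (-1))//;
    [|by rewrite mulrNN mulr1|by rewrite gtrBl|by move=> y; lra].
  have -> : -1 * (q - L - q) + d = L + d by ring.
  have -> : -1 * (q - q) + d = d by ring.
  by rewrite -EFinB /M; congr EFin; ring.
have cover : window x h `<=` [set` `[q - L, q]] `|` [set` `]q, q + L]].
  move=> y /=; rewrite !in_itv/= => xhy.
  have := ler_norm (x - q); have := ler_norm (q - x); rewrite distrC /L => ? ?.
  by have [|] := leP y q => yq; [left|right]; lra.
have M_le : M <= Num.sqrt L.
  rewrite lerBlDr -[leRHS]ger0_norm ?addr_ge0 ?sqrtr_ge0//.
  rewrite -sqrtr_sqr ler_sqrt ?sqr_ge0//.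
  rewrite sqrrD !sqr_sqrtr ?(ltW d0) ?(ltW L0)//.
  by rewrite lerD2r lerDl mulrn_wge0// mulr_ge0 ?sqrtr_ge0.
apply: (@le_trans _ _ (4 * M)%:E).
  apply: (@le_trans _ _ (\int[lam]_(y in
      [set` `[(q - L)%R, q]] `|` [set` `]q, (q + L)%R]]) (spike q d y)%:E)%E).
    apply: ge0_subset_integral => //; first exact: measurableU.
    exact: mspike.
  rewrite ge0_integral_setU//; [|exact: mspike|].
  2: {
    apply/disj_setPS => y /= []; rewrite !in_itv/= => /andP[_ yq] /andP[qy _].
    by move: qy; rewrite ltNge yq. }
  rewrite left_side integral_itv_obnd_cbnd; last exact: mspike.
  by rewrite right_side -EFinD lee_fin; lra.
rewrite lee_fin ler_pdivlMr; last by rewrite sqrtr_gt0 ltr_wpDl.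
apply: (@le_trans _ _ (4 * (Num.sqrt L * Num.sqrt (`|x - q| + d)))).
  by rewrite -mulrA ler_wpM2l// ler_wpM2r// sqrtr_ge0.
rewrite -[16]/(4 * 4)%:R natrM -!mulrA ler_wpM2l//.
rewrite -sqrtrM ?(ltW L0)// -[leRHS](@ger0_norm _ (4 * h)) ?mulr_ge0 ?(ltW h0)//.
rewrite -(sqrtr_sqr (4 * h)) ler_sqrt ?sqr_ge0// /L.
have := ler_wpM2l (ltW h0) (ltW rh); have := mulr_gt0 h0 h0; lra.
Qed.
End spike.

(** * Discontinuity of compositions *)

Section discontinuity.
Variable R : realType.

(** Arbitrarily close to [x] the function [f] takes every value in [(0, f x)],
so continuity of [phi \o f] at [x] makes [phi] constant on that interval; the
constant is [phi 0 = 0] by continuity of [phi]. *)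
Lemma comp_discontinuous (f phi : R -> R) (x : R) :
  measurable_fun setT f -> (forall y, approx_continuous_at f y) ->
  (forall e : R, 0 < e -> exists2 y, `|x - y| < e & f y = 0) ->
  {for 0, continuous phi} -> phi 0 = 0 ->
  (exists2 t0 : R, 0 < t0 & forall t, 0 < t < t0 -> phi t != 0) ->
  0 < f x -> ~ {for x, continuous (phi \o f)}.
Proof.
move=> mf cf dense0 cphi phi0 [t0 t00 phi_neq0] fx cphif.
have const t : 0 < t < f x -> phi t = phi (f x).
  move=> /andP[t_gt0 tfx]; apply/eqP; apply/negP => /negP neq.
  have e0 : 0 < `|phi (f x) - phi t| by rewrite normr_gt0 subr_eq0 eq_sym.
  have /cvgrPdist_lt/(_ _ e0)/nbhs_ballP[r /= r0 xr] := cphif.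
  have [y xy fy] := dense0 r r0.
  have [|c cxy fc] := @approx_continuous_ivt R f y x t mf cf; first by rewrite fy t_gt0.
  have /xr /= : ball x r c.
    rewrite /ball/=; move: xy cxy; rewrite !ltr_norml.
    by have [] := leP y x => yx; lra.
  by rewrite fc ltxx.
have phi_fx : phi (f x) = 0.
  apply/eqP; rewrite -normr_le0; apply/ler_addgt0Pr => e e0; rewrite add0r.
  have /cvgrPdist_lt/(_ _ e0)/nbhs_ballP[r /= r0 xr] := cphi.
  pose t := Num.min (r / 2) (f x / 2).
  have t_gt0 : 0 < t by rewrite lt_min !divr_gt0.
  have tr : t <= r / 2 by rewrite ge_min lexx.
  have tf : t <= f x / 2 by rewrite ge_min lexx orbT.
  rewrite -(const t) ?t_gt0/=; last lra.
  have := xr t; rewrite /ball/= phi0 !sub0r !normrN => /(_ _)/ltW; apply.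
  by rewrite gtr0_norm//; lra.
pose t := Num.min (t0 / 2) (f x / 2).
have t_gt0 : 0 < t by rewrite lt_min !divr_gt0.
have tr : t <= t0 / 2 by rewrite ge_min lexx.
have tf : t <= f x / 2 by rewrite ge_min lexx orbT.
have /eqP := phi_neq0 t ltac:(lra); apply.
by rewrite const//; lra.
Qed.

End discontinuity.

(** * A potential finite almost everywhere, infinite on a dense set *)

Section bumps.
Variable R : realType.

(** An index encodes a rational and a natural number: the centre and the height
of a bump.  Thus every nonzero rational is the centre of bumps of all heights.
The origin is avoided as a centre, since the potential is to be finite there. *)
Definition bump_center (n : nat) : R :=
  if (unpickle n : option (rat * nat)) is Some (r, _)
  then (if r == 0 then 1 else ratr r) else 1.
Definition bump_height (n : nat) : nat :=
  if (unpickle n : option (rat * nat)) is Some (_, m) then m else 0%N.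
(** The factor [sqrt |q|] cancels the spike at the origin, so that the bumps are
summable there whatever their widths. *)
Definition bump_coef (n : nat) : R := 1 / (2 ^ n.+1)%:R * Num.sqrt `|bump_center n|.
(** The width for which the bump has height [(bump_height n).+1] at its centre. *)
Definition bump_width (n : nat) : R := (bump_coef n / (bump_height n).+1%:R) ^+ 2.
Definition bump (n : nat) (x : R) : R :=
  bump_coef n * spike (bump_center n) (bump_width n) x.

Lemma bump_center_neq0 n : bump_center n != 0.
Proof.
rewrite /bump_center; case: unpickle => [[r m]|]; last exact: oner_neq0.
by case: ifP => [_|/negbT r0]; rewrite ?oner_neq0// fmorph_eq0.
Qed.

Lemma bump_coef_gt0 n : 0 < bump_coef n.
Proof.
rewrite mulr_gt0// ?divr_gt0// ?ltr0n ?expn_gt0//.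
by rewrite sqrtr_gt0 normr_gt0 bump_center_neq0.
Qed.

Lemma bump_width_gt0 n : 0 < bump_width n.
Proof. by rewrite exprn_gt0// divr_gt0// bump_coef_gt0. Qed.

Lemma bump_gt0 n x : 0 < bump n x.
Proof. by rewrite mulr_gt0// ?bump_coef_gt0// spike_gt0// bump_width_gt0. Qed.

Lemma bump_cont n : continuous (bump n).
Proof.
move=> x; apply: cvgM; first exact: cvg_cst.
by apply: spike_cont; exact: bump_width_gt0.
Qed.

Lemma bump_average : average_bounded 16 bump.
Proof.
move=> n x h h0; rewrite /bump.
under eq_integral do rewrite EFinM.
rewrite ge0_integralZl_EFin//.
- rewrite mulrCA [leRHS]EFinM lee_pmul2l// ?lte_fin ?bump_coef_gt0//.
  by apply: spike_average => //; exact: bump_width_gt0.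
- by move=> y _; rewrite lee_fin ltW// spike_gt0// bump_width_gt0.
- apply/measurable_EFinP; apply: measurable_funTS.
  by apply: continuous_measurable_fun; apply: spike_cont; exact: bump_width_gt0.
- by rewrite ltW// bump_coef_gt0.
Qed.

Lemma bump_at_center n : bump n (bump_center n) = (bump_height n).+1%:R.
Proof.
have c0 := bump_coef_gt0 n.
rewrite /bump /spike subrr normr0 add0r /bump_width sqrtr_sqr gtr0_norm ?divr_gt0//.
by rewrite invf_div mulrCA divff ?mulr1// gt_eqF.
Qed.

Lemma bump_at_0 n : bump n 0 <= 1 / (2 ^ n.+1)%:R.
Proof.
rewrite /bump /bump_coef -(mulrA (1 / _)) -[leRHS]mulr1 ler_wpM2l ?divr_ge0//.
have c0 : 0 < `|bump_center n| by rewrite normr_gt0 bump_center_neq0.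
rewrite /spike sub0r normrN ler_pdivrMr ?mul1r; last first.
  by rewrite sqrtr_gt0 ltr_wpDr// ltW// bump_width_gt0.
by rewrite ler_sqrt ?lerDl ?ltW// ?bump_width_gt0// addr_gt0// bump_width_gt0.
Qed.

Lemma bump_potential_0 : (potential bump 0 < +oo)%E.
Proof.
apply: (@le_lt_trans _ _ 1%:E); last exact: ltry.
apply: le_trans _ (epsilon_trick0 xpredT ler01).
apply: lee_nneseries => n *; first by rewrite lee_fin ltW// bump_gt0.
by rewrite lee_fin; exact: bump_at_0.
Qed.

Lemma bump_potential_rat (r : rat) : r != 0 -> potential bump (ratr r) = +oo%E.
Proof.
move=> r0; apply/eqyP => A A0.
pose n := pickle (r, Num.truncn A).
have cn : bump_center n = ratr r by rewrite /bump_center pickleK (negbTE r0).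
have hn : bump_height n = Num.truncn A by rewrite /bump_height pickleK.
have ge0 k : 0 <= bump k (ratr r) by rewrite ltW// bump_gt0.
apply: le_trans (partial_le_potential (fun k x => ltW (bump_gt0 k x)) n.+1 (ratr r)).
rewrite lee_fin /partial big_nat_recr//= -{2}cn bump_at_center hn.
rewrite ler_wpDl ?sumr_ge0// ltW//; exact: truncnS_gt.
Qed.

Lemma bump_dip_dense0 (x e : R) : 0 < e ->
  exists2 y, `|x - y| < e & dip bump y = 0.
Proof.
move=> e0.
suff [r r0 xr] : exists2 r : rat, r != 0 & `|x - ratr r| < e.
  by exists (ratr r) => //; rewrite /dip bump_potential_rat.
have [x0|x0] := leP 0 x.
  have [r] := @rat_in_itvoo R x (x + e) ltac:(lra).
  rewrite in_itv/= => /andP[xr rx]; exists r; last by rewrite ltr_norml; lra.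
  by rewrite -(fmorph_eq0 (ratr : rat -> R)) gt_eqF//; lra.
have [|r] := @rat_in_itvoo R x (Num.min (x + e) 0); first by rewrite lt_min; lra.
rewrite in_itv/= lt_min => /and3P[xr rx r0]; exists r; last by rewrite ltr_norml; lra.
by rewrite -(fmorph_eq0 (ratr : rat -> R)) lt_eqF.
Qed.

End bumps.

(** * Exponential sums with pairwise incomparable exponents *)

Section exponential_sums.
Variable R : realType.

Lemma expR_mul_cvg0 (c : R) : 0 < c -> expR (- (c * t)) @[t --> +oo] --> 0.
Proof.
move=> c0; apply: (@cvg_comp _ _ _ (fun t : R => c * t) (fun z => expR (- z))).
  by apply: gt0_cvgMry => //; exact: cvg_id.
exact: cvgr_expR.
Qed.

Lemma cvg_sum_seq (I : eqType) (s : seq I) (F : I -> R -> R) (l : I -> R) :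
  (forall i, i \in s -> F i t @[t --> +oo] --> l i) ->
  (\sum_(i <- s) F i t) @[t --> +oo] --> \sum_(i <- s) l i.
Proof.
move=> Fl; rewrite big_seq; under eq_cvg do rewrite big_seq.
by apply: cvg_big => //; exact: add_continuous.
Qed.

(** Divided by [exp (b i0 * t)], the form tends to [d i0]. *)
Lemma exp_form_leading (k : nat) (b d : 'I_k -> R) (i0 : 'I_k) :
  0 < b i0 -> 0 < d i0 -> (forall i, i != i0 -> d i != 0 -> b i < b i0) ->
  (\sum_i d i * expR (b i * t)) @[t --> +oo] --> +oo.
Proof.
move=> b0 d0 lead.
have quot : (\sum_i d i * expR ((b i - b i0) * t)) @[t --> +oo] --> d i0.
  have -> : d i0 = \sum_i (if i == i0 then d i else 0).
    by rewrite -big_mkcond big_pred1_eq.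
  apply: cvg_sum_seq => i _; have [->|ii0] := eqVneq i i0.
    by under eq_cvg do rewrite subrr mul0r expR0 mulr1; exact: cvg_cst.
  have [->|di] := eqVneq (d i) 0.
    by under eq_cvg do rewrite mul0r; exact: cvg_cst.
  rewrite -(mulr0 (d i)); apply: cvgM; first exact: cvg_cst.
  under eq_cvg do rewrite -(opprB (b i0)) mulNr.
  by apply: expR_mul_cvg0; rewrite subr_gt0 lead.
apply/cvgryPge => A; near=> t.
have -> : \sum_i d i * expR (b i * t) =
    expR (b i0 * t) * \sum_i d i * expR ((b i - b i0) * t).
  rewrite mulr_sumr; apply: eq_bigr => i _.
  by rewrite mulrCA -expRD; congr (_ * expR _); ring.
have q : d i0 / 2 <= \sum_i d i * expR ((b i - b i0) * t).
  by near: t; move/cvgr_ge : quot; apply; rewrite ltr_pdivrMr// ltr_pMr// ltr1n.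
apply: le_trans (ler_norm A) _.
have {1}-> : `|A| = `|A| / (d i0 / 2) * (d i0 / 2) by rewrite divfK// gt_eqF// divr_gt0.
apply: ler_pM => //; [by rewrite divr_ge0// divr_ge0 ?ltW|by rewrite divr_ge0 ?ltW|].
apply: le_trans (_ : b i0 * t <= _); last first.
  by apply: le_trans (expR_ge1Dx _); rewrite lerDr.
rewrite -ler_pdivrMl//; near: t; exact: nbhs_pinfty_ge.
Unshelve. all: by end_near. Qed.

Lemma exp_form_diverges (k : nat) (b d : 'I_k -> R) :
  (forall i, 0 < b i) -> injective b -> (exists i, d i != 0) ->
  (\sum_i d i * expR (b i * t)) @[t --> +oo] --> +oo \/
  (\sum_i (- d i) * expR (b i * t)) @[t --> +oo] --> +oo.
Proof.
move=> b_gt0 b_inj [i di].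
case: (@Order.TotalTheory.arg_maxP _ _ _ i (fun i => d i != 0) b di) => i0 di0 maxi0.
have lt_i0 j : j != i0 -> d j != 0 -> b j < b i0.
  move=> ji0 dj; have le_j : b j <= b i0 by exact: maxi0.
  rewrite lt_neqAle le_j andbT.
  by apply: contraNneq ji0 => /b_inj ->.
have [di0_gt0|di0_lt0|di0_eq0] := ltgtP 0 (d i0).
- by left; exact: (@exp_form_leading _ _ _ i0).
- right; apply: (@exp_form_leading _ _ (fun i => - d i) i0) => //.
    by rewrite oppr_gt0.
  by move=> j ji0; rewrite oppr_eq0; exact: lt_i0.
- by rewrite -di0_eq0 eqxx in di0.
Qed.

(** Divergence of the differences to [+oo] is a strict order, total on [s] by
assumption, so a finite [s] has a least element. *)
Lemma slowest_exponent (I : eqType) (s : seq I) (w : I -> R -> R) :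
  s != [::] ->
  {in s &, forall i j, i != j -> (w i t - w j t) @[t --> +oo] --> +oo \/
                                 (w j t - w i t) @[t --> +oo] --> +oo} ->
  exists2 j, j \in s &
    forall i, i \in s -> i != j -> (w i t - w j t) @[t --> +oo] --> +oo.
Proof.
elim: s => // a s IH _ cmp.
have [s0|s0] := eqVneq s [::].
  exists a; first exact: mem_head.
  by move=> i; rewrite s0 inE => ->.
have [|j js jmin] := IH s0.
  by move=> i j is_ js; apply: cmp; rewrite inE ?is_ ?js orbT.
have [aj|aj] := eqVneq a j.
  exists j; first by rewrite inE js orbT.
  by move=> i; rewrite inE aj => /orP[->//|]; exact: jmin.
have [] := cmp a j _ _ aj; rewrite ?inE ?eqxx ?js ?orbT// => dom.
  exists j; first by rewrite inE js orbT.
  by move=> i; rewrite inE => /orP[/eqP ->//|]; exact: jmin.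
exists a; first exact: mem_head.
move=> i; rewrite inE => /orP[->//|is_ ia].
have [->//|ij] := eqVneq i j.
have iw := jmin i is_ ij.
apply/cvgryPge => A; near=> t.
rewrite -(subrKA (w j t)) -[A]addr0; apply: lerD; near: t.
  by move/cvgryPge : iw; exact.
by move/cvgryPge : dom; exact.
Unshelve. all: by end_near. Qed.

(** Divided by the exponential with the slowest exponent, the sum tends to the
coefficient of that exponential. *)
Lemma exp_sum_neq0 (I : eqType) (s : seq I) (c : I -> R) (w : I -> R -> R) :
  s != [::] -> uniq s -> (forall i, i \in s -> c i != 0) ->
  {in s &, forall i j, i != j -> (w i t - w j t) @[t --> +oo] --> +oo \/
                                 (w j t - w i t) @[t --> +oo] --> +oo} ->
  \forall t \near +oo, \sum_(i <- s) c i * expR (- w i t) != 0.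
Proof.
move=> s0 us c0 cmp; have [j js jmin] := slowest_exponent s0 cmp.
have quot : (\sum_(i <- s) c i * expR (- (w i t - w j t))) @[t --> +oo] --> c j.
  have -> : c j = \sum_(i <- s) (if i == j then c i else 0).
    rewrite (bigD1_seq j)//= eqxx big1 ?addr0// => i /negbTE ->.
    by [].
  apply: cvg_sum_seq => i is_; have [->|ij] := eqVneq i j.
    by under eq_cvg do rewrite subrr oppr0 expR0 mulr1; exact: cvg_cst.
  rewrite -(mulr0 (c i)); apply: cvgM; first exact: cvg_cst.
  apply: (@cvg_comp _ _ _ (fun t => w i t - w j t) (fun z => expR (- z))).
    exact: jmin.
  exact: cvgr_expR.
near=> t.
have : \sum_(i <- s) c i * expR (- (w i t - w j t)) != 0.
  near: t; move/cvgrPdist_lt: quot => /(_ `|c j|); rewrite normr_gt0 c0// => /(_ isT).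
  by apply: filterS => t; apply: contraTneq => ->; rewrite subr0 ltxx.
apply: contraNneq => sum0; apply/eqP.
transitivity (expR (w j t) * \sum_(i <- s) c i * expR (- w i t)); last first.
  by rewrite sum0 mulr0.
rewrite mulr_sumr; apply: eq_bigr => i _.
by rewrite mulrCA -expRD; congr (_ * expR _); ring.
Unshelve. all: by end_near. Qed.

End exponential_sums.

(** * Germs at zero that generate a free algebra *)

Section generators.
Variable R : realType.

(** For [t > 0] this is [exp (- t ^ (- b))].  Distinct exponents [b] are enough
for algebraic independence; powers [t ^ b] would require exponents that are
linearly independent over the rationals. *)
Definition theta (b t : R) : R :=
  if 0 < t then expR (- expR (- (b * ln t))) else 0.

Lemma theta_le0 b t : t <= 0 -> theta b t = 0.
Proof. by move=> t0; rewrite /theta ltNge t0. Qed.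

Lemma theta_expR b t : theta b (expR (- t)) = expR (- expR (b * t)).
Proof. by rewrite /theta expR_gt0 expRK mulrN opprK. Qed.

Lemma theta_cont b : 0 < b -> continuous (theta b).
Proof.
move=> b0 t; have [t0|t0|<-] := ltgtP 0 t.
- have cexp : {for t, continuous (fun s => expR (- expR (- (b * ln s))))}.
    apply: continuous_comp; last exact: continuous_expR.
    apply: cvgN; apply: continuous_comp; last exact: continuous_expR.
    apply: cvgN; apply: cvgM; first exact: cvg_cst.
    exact: continuous_ln.
  have thetaE : {near t, (fun s => expR (- expR (- (b * ln s)))) =1 theta b}.
    near=> s; rewrite /theta ifT//; near: s.
    exact: lt_nbhsr.
  apply: cvg_trans (near_eq_cvg thetaE) _.
  by have -> : theta b t = expR (- expR (- (b * ln t))) by rewrite /theta t0.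
- rewrite /continuous_at theta_le0 ?ltW//.
  have thetaE : {near t, cst 0 =1 theta b}.
    near=> s; rewrite theta_le0// ltW//; near: s; exact: lt_nbhsl.
  by apply: cvg_trans (near_eq_cvg thetaE) _; exact: cvg_cst.
(* From exp x >= x, theta b s <= s ^ b, which is below e for
   s < e ^ (1 / b). *)
- apply/cvgrPdist_lt => e e0; rewrite theta_le0//.
  near=> s; rewrite sub0r normrN.
  have [s0|s0] := ltP 0 s; last by rewrite theta_le0// normr0.
  rewrite /theta s0 ger0_norm ?expR_ge0//.
  rewrite -[e]lnK ?posrE// ltr_expR.
  have := expR_ge1Dx (- (b * ln s)).
  suff : b * ln s < ln e by lra.
  rewrite -ltr_pdivlMl// -ltr_expR lnK ?posrE//.
  near: s; apply: lt_nbhsl; exact: expR_gt0.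
Unshelve. all: by end_near. Qed.

Definition poly_theta (k : nat) (P : mpoly k R) (b : 'I_k -> R) (t : R) : R :=
  \sum_(m <- msupp P) mcoeff m P * \prod_i theta (b i) t ^+ m i.

Lemma poly_theta_cont (k : nat) (P : mpoly k R) (b : 'I_k -> R) :
  (forall i, 0 < b i) -> continuous (poly_theta P b).
Proof.
move=> b0 t; rewrite /poly_theta /continuous_at.
apply: cvg_big => [|m _]; first exact: add_continuous.
apply: cvgM; first exact: cvg_cst.
apply: cvg_big => [|i _]; first exact: mul_continuous.
apply: (@cvg_comp _ _ _ (theta (b i)) (fun z => z ^+ m i)); first exact: theta_cont.
exact: exprn_continuous.
Qed.

Lemma poly_theta0 (k : nat) (P : mpoly k R) (b : 'I_k -> R) :
  mcoeff (@mnm0 k) P = 0 -> poly_theta P b 0 = 0.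
Proof.
move=> P0; rewrite /poly_theta big1_seq// => m /andP[_ mP].
have [m0|m_neq0] := eqVneq m mnm0.
  by rewrite m0 P0 mul0r.
have [i mi] : exists i, m i != 0%N.
  apply: contrapT => all0; move/eqP: m_neq0; apply; apply/mnmP => i.
  by rewrite mnm0E; apply/eqP/negPn/negP => mi; apply: all0; exists i.
by rewrite (bigD1 i)//= theta_le0// expr0n (negbTE mi) mul0r mulr0.
Qed.

(** At [t = exp (- tau)] the monomials become exponentials whose exponents are
the forms [\sum_i m i * exp (b i * tau)]; for distinct multi-exponents their
difference is a nonzero form, hence diverges. *)
Lemma poly_theta_neq0 (k : nat) (P : mpoly k R) (b : 'I_k -> R) :
  (forall i, 0 < b i) -> injective b -> P != 0 ->
  exists2 t0 : R, 0 < t0 & forall t, 0 < t < t0 -> poly_theta P b t != 0.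
Proof.
move=> b0 b_inj P0.
pose w (m : multinom k) t := \sum_i (m i)%:R * expR (b i * t).
have polyE t : poly_theta P b (expR (- t)) =
    \sum_(m <- msupp P) mcoeff m P * expR (- w m t).
  apply: eq_bigr => m _; congr (_ * _).
  rewrite /w -sumrN expR_sum; apply: eq_bigr => i _.
  by rewrite theta_expR -expRM_natl mulrN.
have := @exp_sum_neq0 R _ (msupp P) (fun m => mcoeff m P) w.
have s0 : msupp P != [::] by rewrite msupp_eq0.
move=> /(_ s0 (msupp_uniq P)) [||M [_ MP]].
- by move=> m; rewrite mcoeff_msupp.
- move=> m m' _ _ mm'.
  have [|dom|dom] := @exp_form_diverges R k b (fun i => (m i)%:R - (m' i)%:R) b0 b_inj.
  + apply: contrapT => all0; move/eqP: mm'; apply; apply/mnmP => i.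
    apply/eqP; rewrite -(eqr_nat R) -subr_eq0; apply/negPn/negP => mi.
    by apply: all0; exists i.
  + left; move: dom; apply: cvg_trans; apply: near_eq_cvg; near=> t.
    by rewrite /w -sumrB; apply: eq_bigr => i _; rewrite mulrBl.
  + right; move: dom; apply: cvg_trans; apply: near_eq_cvg; near=> t.
    by rewrite /w -sumrB; apply: eq_bigr => i _; rewrite opprB mulrBl.
exists (expR (- M)); first exact: expR_gt0.
move=> t /andP[t0 tM].
rewrite -[t]lnK ?posrE// -[ln t]opprK polyE; apply: MP.
by rewrite ltrNr -ltr_expR lnK.
Unshelve. all: by end_near. Qed.

Lemma theta_inj_exponent (t : R) : 0 < t < 1 -> injective (theta ^~ t).
Proof.
move=> /andP[t0 t1] b b'; rewrite /theta t0.
move=> /expR_inj/oppr_inj/expR_inj/oppr_inj; apply: mulIf.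
by rewrite lt_eqF// ln_lt0// t0.
Qed.

End generators.

(** * Continuum many exponents *)

Section cantor_injection.
Variable R : realType.

(** Base [3] with digits [0] and [1] only: all the digits after a given place
together weigh at most half as much as a unit at that place, so the first
difference decides. *)
Definition digits (s : nat -> bool) (n : nat) : R :=
  \sum_(0 <= i < n) (s i)%:R / 3 ^+ i.

Lemma digits_le s m n : (n <= m)%N ->
  digits s n <= digits s m <= digits s n + 3 / 2 * (3 ^- n - 3 ^- m).
Proof.
move=> /subnKC <-; elim: (m - n)%N => [|k /andP[lo hi]].
  by rewrite addn0 subrr mulr0 addr0 lexx.
have -> : digits s (n + k.+1) = digits s (n + k) + (s (n + k)%N)%:R / 3 ^+ (n + k).
  by rewrite addnS /digits big_nat_recr.
have p : 0 < 3 ^- (n + k) :> R by rewrite invr_gt0 exprn_gt0.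
have pS : 3 ^- (n + k.+1) = 3^-1 * 3 ^- (n + k) :> R by rewrite addnS exprS invfM.
rewrite pS; case: (s _); rewrite ?mul1r ?mul0r; lra.
Qed.

Definition ternary (s : nat -> bool) : R := sup (range (digits s)).

Lemma digits_has_ubound s : has_ubound (range (digits s)).
Proof.
exists (3 / 2) => _ [m _ <-]; have /andP[_] := digits_le s (leq0n m).
have : 0 < 3 ^- m :> R by rewrite invr_gt0 exprn_gt0.
have -> : digits s 0 = 0 by rewrite /digits big_geq.
have -> : 3 ^- 0 = 1 :> R by rewrite expr0 invr1.
lra.
Qed.

Lemma ternary_lt s s' n : (forall i, (i < n)%N -> s i = s' i) ->
  s n = false -> s' n = true -> ternary s < ternary s'.
Proof.
move=> agree sn s'n.
have p : 0 < 3 ^- n :> R by rewrite invr_gt0 exprn_gt0.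
have pS : 3 ^- n.+1 = 3^-1 * 3 ^- n :> R by rewrite exprS invfM.
have digits_n : digits s n = digits s' n.
  by apply: eq_big_nat => i /andP[_ ni]; rewrite agree.
have lo : digits s n + 3 ^- n <= ternary s'.
  apply: (@le_trans _ _ (digits s' n.+1)).
    by rewrite /digits big_nat_recr//= s'n mul1r -/(digits s' n) -/(digits s n) digits_n.
  by apply: ub_le_sup; [exact: digits_has_ubound|exists n.+1].
apply: lt_le_trans lo.
apply: (@le_lt_trans _ _ (digits s n + 3 / 2 * 3 ^- n.+1)); last by rewrite pS; lra.
apply: ge_sup; first by exists (digits s 0), 0%N.
move=> _ [m _ <-].
have q : 0 < 3 ^- m :> R by rewrite invr_gt0 exprn_gt0.
have snS : digits s n.+1 = digits s n by rewrite /digits big_nat_recr//= sn mul0r addr0.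
have [mn|nm] := leqP m n.+1.
  by have /andP[+ _] := digits_le s mn; rewrite snS; lra.
by have /andP[_] := digits_le s (ltnW nm); rewrite snS; lra.
Qed.

Lemma ternary_inj : injective ternary.
Proof.
move=> s s' eq_ss'; apply: contrapT => /eqP neq.
have ex : exists n, s n != s' n.
  apply: contrapT => all_eq; move/eqP: neq; apply; apply/funext => n.
  by apply/eqP/negPn/negP => sn; apply: all_eq; exists n.
case: (ex_minnP ex) => n neq_n min_n.
have agree i : (i < n)%N -> s i = s' i.
  by move=> ni; apply/eqP/negPn/negP => /min_n; rewrite leqNgt ni.
case sn: (s n); case s'n: (s' n); rewrite ?sn ?s'n// in neq_n.
  have := ternary_lt (fun i ni => esym (agree i ni)) s'n sn.
  by rewrite eq_ss' ltxx.
by have := ternary_lt agree sn s'n; rewrite eq_ss' ltxx.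
Qed.

End cantor_injection.

(** * The free algebra *)

Section generated_algebra.
Variable R : realType.

Lemma poly_value_theta (f : R -> R) (k : nat) (P : mpoly k R) (b : 'I_k -> R)
    (y : 'I_k -> R -> R) :
  (forall i, y i = theta (b i) \o f) ->
  poly_value P y = poly_theta P b \o f.
Proof.
move=> yE; apply/funext => x; rewrite /poly_value /mmap fct_sumE /=.
rewrite /poly_theta; apply: eq_bigr => m _.
transitivity (mcoeff m P * mmap1 y m x); first by rewrite mulr_algl.
congr (_ * _); rewrite /mmap1 fct_prodE; apply: eq_bigr => i _.
rewrite yE; elim: (m i) => [|n IH]; first by rewrite !expr0.
by rewrite !exprS -IH.
Qed.

Definition generator (s : nat -> bool) : R -> R :=
  theta (expR (ternary R s)) \o dip (@bump R).

Lemma bump_approx_continuous (x : R) : approx_continuous_at (dip (@bump R)) x.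
Proof.
apply: (@dip_approx_continuous R 16) => //.
- by move=> n y; rewrite ltW// bump_gt0.
- exact: bump_cont.
- exact: bump_average.
Qed.

Lemma measurable_bump_dip : measurable_fun setT (dip (@bump R)).
Proof.
apply: measurable_dip; first by move=> n y; rewrite ltW// bump_gt0.
exact: bump_cont.
Qed.

Lemma bump_dip_gt0 (x : R) : (potential (@bump R) x < +oo)%E -> 0 < dip (@bump R) x.
Proof.
move=> fin; apply: damp_gt0 => //; apply: potential_ge0 => n y.
by rewrite ltW// bump_gt0.
Qed.

Lemma bump_dip0_lt1 : dip (@bump R) 0 < 1.
Proof.
have b0 := bump_gt0 0 (0 : R).
have ge0 n (y : R) : 0 <= bump n y by rewrite ltW// bump_gt0.
apply: (@le_lt_trans _ _ (1 + partial (@bump R) 1 0)^-1).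
  by apply: damp_le; [exact: partial_ge0|exact: partial_le_potential].
by rewrite invf_lt1 /partial big_nat1; lra.
Qed.

Lemma generator_inj : injective generator.
Proof.
move=> s s' /(congr1 (fun g => g 0)) /=.
have t01 : 0 < dip (@bump R) 0 < 1.
  by rewrite bump_dip0_lt1 bump_dip_gt0//; exact: bump_potential_0.
by move=> /(theta_inj_exponent t01)/expR_inj/ternary_inj.
Qed.

Lemma poly_theta_dip_discontinuous (k : nat) (P : mpoly k R) (b : 'I_k -> R) (x : R) :
  (forall i, 0 < b i) -> injective b -> P != 0 -> mcoeff (@mnm0 k) P = 0 ->
  (potential (@bump R) x < +oo)%E ->
  ~ {for x, continuous (poly_theta P b \o dip (@bump R))}.
Proof.
move=> b0 b_inj P0 Pm0 fin.
have phi_cont : {for 0, continuous (poly_theta P b)}.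
  by have := @poly_theta_cont R k P b b0 0.
exact: (comp_discontinuous measurable_bump_dip bump_approx_continuous
  (bump_dip_dense0 x) phi_cont (poly_theta0 b Pm0) (poly_theta_neq0 b0 b_inj P0)
  (bump_dip_gt0 fin)).
Qed.

End generated_algebra.

(* (nat -> bool) has cardinality 2 ^ omega. *)
Theorem theorem4p3 (R : realType) :
  @strongly_algebrable R (R -> R) (nat -> bool)
    [set f : R -> R | approximately_continuous f /\ ae_discontinuous f].
Proof.
exists (range (@generator R)); split.
  by apply: inj_card_eq => s s' _ _; exact: generator_inj.
move=> k P y k0 P0 Pm0 y_inj yX.
have /choice[s sE] i : exists s, @generator R s = y i.
  by have [s _ <-] := yX i; exists s.
pose b i := expR (ternary R (s i)).
have b_gt0 i : 0 < b i by exact: expR_gt0.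
have b_inj : injective b.
  move=> i j /expR_inj/ternary_inj sij; apply: y_inj.
  by rewrite -!sE sij.
rewrite (@poly_value_theta R (dip (@bump R)) k P b y); last by move=> i; rewrite -sE.
have disc x : (potential (@bump R) x < +oo)%E ->
  ~ {for x, continuous (poly_theta P b \o dip (@bump R))}.
  exact: poly_theta_dip_discontinuous.
split.
  apply/eqP => value0; apply: (disc 0 (bump_potential_0 R)).
  by rewrite value0; exact: cvg_cst.
split.
  apply: approximately_continuous_pointwise.
    apply: measurableT_comp; last exact: measurable_bump_dip.
    by apply: continuous_measurable_fun; exact: poly_theta_cont.
  move=> x; apply: approx_continuous_at_comp.
  - exact: measurable_bump_dip.
  - exact: poly_theta_cont.
  - exact: bump_approx_continuous.
have := potential_ae_finite (ltr0Sn R 15) (fun n x => ltW (bump_gt0 n x))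
  (@bump_cont R) (@bump_average R) (bump_potential_0 R).
by apply: (@filterS _ _ (ae_filter_ringOfSetsType _)) => x; exact: disc.
Qed.
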